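(* Let $(X,d_X,\mathcal{C}_X)$ and $(Y,d_Y,\mathcal{C}_Y)$ be two distinct chasing environments. Suppose there exists a bi-Lipschitz metric embedding $f:(X,d_X)\to(Y,d_Y)$ with distortion $D(f)=\mathrm{Lip}(f)\,\mathrm{Lip}(f^{-1})$ such that $f(K)\in\mathcal{C}_Y$ for every $K\in\mathcal{C}_X$. Then every deterministic online algorithm $\mathcal{A}_Y$ for the $(Y,d_Y,\mathcal{C}_Y)$-chasing problem, with competitive ratio $C(\mathcal{A}_Y)$, induces through $f^{-1}$ a deterministic online algorithm $\mathcal{A}_X$ for the $(X,d_X,\mathcal{C}_X)$-chasing problem such that $C(\mathcal{A}_X)\le C(\mathcal{A}_Y)\,D(f)$.
   Context: Chasing environment $(X,d,\mathcal{C})$: $(X,d)$ is a metric space and $\mathcal{C}\subseteq 2^X$ is a collection of subsets of $X$. In the $(X,d,\mathcal{C})$-chasing problem an online player starts at a point $x_0\in X$; at each time $t=1,\dots,T$ ($T\in\mathbb{N}$) a set $K_t\in\mathcal{C}$ is revealed. A deterministic online algorithm $\mathcal{A}$ chooses $x_t\in K_t$ as a function of $x_0,K_1,\dots,K_t$ only. Its cost is $\sum_{t=1}^T d(x_t,x_{t-1})$, and the offline optimum is $\inf\{\sum_{t=1}^T d(a_t,a_{t-1}): a_t\in K_t\ \forall t\ge 1,\ a_0=x_0\}$. The competitive ratio $C(\mathcal{A})\in[1,\infty]$ is the supremum of cost divided by offline optimum over all $x_0\in X$, all $T\in\mathbb{N}$ and all request sequences $K_1,\dots,K_T\in\mathcal{C}$.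 Bi-Lipschitz embedding: an injective map $f:X\to Y$ such that $f$ and $f^{-1}:f(X)\to X$ are Lipschitz; $\mathrm{Lip}(\cdot)$ denotes the least Lipschitz constant. Algorithm induced through $f^{-1}$: given starting point $x_0$ and requests $K_1,\dots,K_t\in\mathcal{C}_X$, let $y_t\in f(K_t)$ be the response of $\mathcal{A}_Y$ at time $t$ when started at $y_0=f(x_0)$ with requests $f(K_1),\dots,f(K_t)$; then $\mathcal{A}_X$ responds with $x_t=f^{-1}(y_t)$.
   Formalization: The inequality C(A_X) ≤ C(A_Y) D(f) is asserted only when X has at least two points; if X has at most one point, the least Lipschitz constants are 0, so D(f) = 0 while C(A_X) ≥ 1, and the printed bound fails. *)

(* Defs.v *)
From mathcomp Require Import all_boot all_order all_algebra.
From mathcomp Require Import all_classical all_reals all_analysis.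

Set Implicit Arguments.
Unset Strict Implicit.
Unset Printing Implicit Defensive.

Import Order.TTheory GRing.Theory Num.Theory.

Local Open Scope classical_set_scope.
Local Open Scope ring_scope.

(* An online algorithm is a map A such that A x0 [:: K_1; ...; K_t] is the point
   chosen at time t >= 1. Its values on the empty sequence and on sequences with
   a request outside C are irrelevant: they are used neither here nor in the
   cost of a run. *)
Definition online_algorithm (X : Type) (C : set (set X))
    (A : X -> seq (set X) -> X) : Prop :=
  forall (x0 : X) (Ks : seq (set X)) (K : set X),
    {in Ks, forall K', C K'} -> C K -> K (A x0 (rcons Ks K)).

Definition run (X : Type) (A : X -> seq (set X) -> X) (x0 : X)
    (Ks : seq (set X)) (t : nat) : X :=
  if t is 0%N then x0 else A x0 (take t Ks).

Section Cost.
Variables (R : realType) (X : metricType R).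

Definition path_cost (a : nat -> X) (T : nat) : R :=
  \sum_(1 <= t < T.+1) mdist (a t) (a t.-1).

Definition alg_cost (A : X -> seq (set X) -> X) (x0 : X)
    (Ks : seq (set X)) : R :=
  path_cost (run A x0 Ks) (size Ks).

(* The sequence Ks is indexed from 0, hence K_t is nth set0 Ks t.-1. *)
Definition offline_opt (x0 : X) (Ks : seq (set X)) : \bar R :=
  ereal_inf [set (path_cost a (size Ks))%:E | a in
    [set a : nat -> X | a 0%N = x0 /\
      forall t, (1 <= t <= size Ks)%N -> nth set0 Ks t.-1 (a t)]].

(* The supremum is taken in [1, +oo]. In \bar R, 0^-1 = +oo and 0 * +oo = 0, so
   an instance with optimum 0 contributes +oo when the cost is positive and
   imposes no constraint when the cost is 0. *)
Definition competitive_ratio (C : set (set X))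
    (A : X -> seq (set X) -> X) : \bar R :=
  maxe 1%E (ereal_sup [set r | exists (x0 : X) (Ks : seq (set X)),
    {in Ks, forall K, C K} /\
    r = ((alg_cost A x0 Ks)%:E / offline_opt x0 Ks)%E]).

End Cost.

Section Lipschitz.
Variables (R : realType) (S T : Type).
Variables (dS : S -> S -> R) (dT : T -> T -> R).

Definition lipschitz_with (g : S -> T) (k : R) : Prop :=
  0 <= k /\ forall s s', dT (g s) (g s') <= k * dS s s'.

Definition Lip (g : S -> T) : R := inf [set k | lipschitz_with g k].

End Lipschitz.

(* The inverse f^-1 : f(X) -> X, meaningful for injective f. *)
Definition range_inv (X Y : Type) (f : X -> Y) (y : range f) : X :=
  s2val (cid2 (set_mem (valP y))).

Section Embedding.
Variables (R : realType) (X Y : metricType R) (f : X -> Y).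

Definition range_dist (y y' : range f) : R := mdist (val y) (val y').

Definition bilipschitz_embedding : Prop :=
  [/\ injective f,
      exists k, lipschitz_with (@mdist R X) (@mdist R Y) f k &
      exists k, lipschitz_with range_dist (@mdist R X) (@range_inv X Y f) k].

Definition distortion : R :=
  Lip (@mdist R X) (@mdist R Y) f *
  Lip range_dist (@mdist R X) (@range_inv X Y f).

(* The default x0 is used only for responses outside f(X), which do not occur
   on admissible requests. *)
Definition induced_algorithm (AY : Y -> seq (set Y) -> Y)
    (x0 : X) (Ks : seq (set X)) : X :=
  oapp (@range_inv X Y f) x0 (insub (AY (f x0) [seq f @` K | K <- Ks])).

End Embedding.

(* Main.v *)
(* Write L and L' for the Lipschitz constants of f and f^-1. The runs of A_X on
   (x0, Ks) and of A_Y on (f x0, f(Ks)) correspond under f, so the former costs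
   at most L' times the latter; mapping offline paths by f shows that the optimum
   for f(Ks) is at most L times the optimum for Ks. Two distinct points in X
   force L * L' >= 1, which takes care of the truncation of competitive ratios
   at 1 and of infinite ratios. *)
Require Import Defs.
From mathcomp Require Import all_boot all_order all_algebra.
From mathcomp Require Import all_classical all_reals all_analysis.

Set Implicit Arguments.
Unset Strict Implicit.
Unset Printing Implicit Defensive.

Import Order.TTheory GRing.Theory Num.Theory.

Local Open Scope classical_set_scope.
Local Open Scope ring_scope.

Lemma Lip_ge0 (R : realType) (S T : Type) (dS : S -> S -> R)
    (dT : T -> T -> R) (g : S -> T) :
  0 <= Lip dS dT g.
Proof.
rewrite /Lip.
have [-> |/set0P lip_neq0] := eqVneq [set k | lipschitz_with dS dT g k] set0.
  (* A map that is not Lipschitz has no admissible constant, and the infimum of [set0] is 0. *)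
  by rewrite inf0.
by apply: lb_le_inf => // k [].
Qed.

(** The infimum is attained: for a pair at positive distance, the quotient of distances is a lower
    bound of all admissible constants; at distance 0, any admissible constant gives the
    inequality. *)
Lemma lipschitz_with_Lip (R : realType) (S T : Type) (dS : S -> S -> R)
    (dT : T -> T -> R) (g : S -> T) :
  (forall s s', 0 <= dS s s') ->
  (exists k, lipschitz_with dS dT g k) ->
  lipschitz_with dS dT g (Lip dS dT g).
Proof.
move=> dS_ge0 g_lip; split=> [|s s']; first exact: Lip_ge0.
have [dS0|dS_neq0] := eqVneq (dS s s') 0.
  by case: g_lip => k [_ /(_ s s')]; rewrite dS0 !mulr0.
have dS_gt0 : 0 < dS s s' by rewrite lt_def dS_neq0 dS_ge0.
rewrite -ler_pdivrMr //; apply: lb_le_inf => // k [_ /(_ s s')].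
by rewrite ler_pdivrMr.
Qed.

Lemma range_inv_val (X Y : Type) (f : X -> Y) (y : range f) :
  f (range_inv y) = val y.
Proof. by rewrite /range_inv; case: cid2. Qed.

Lemma dist_le_Lip (R : realType) (X Y : metricType R) (f : X -> Y) (x x' : X) :
  bilipschitz_embedding f ->
  mdist (f x) (f x') <= Lip (@mdist R X) (@mdist R Y) f * mdist x x'.
Proof.
case=> _ f_lip _.
by have [_] := lipschitz_with_Lip (@mdist_ge0 R X) f_lip; apply.
Qed.

Lemma dist_le_Lip_inv (R : realType) (X Y : metricType R) (f : X -> Y)
    (x x' : X) :
  bilipschitz_embedding f ->
  mdist x x' <=
    Lip (@range_dist R X Y f) (@mdist R X) (@range_inv X Y f) *
    mdist (f x) (f x').
Proof.
case=> f_inj _ finv_lip.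
have [|_ lip] := lipschitz_with_Lip _ finv_lip.
  by move=> y y'; exact: mdist_ge0.
(* The Lipschitz bound for the inverse lives on the subtype [range f], so the image points are
   packed into it; injectivity makes [range_inv] return the original points. *)
have fx_range z : f z \in range f by rewrite inE; exists z.
have invE z : range_inv (Sub (f z) (fx_range z) : range f) = z.
  by apply: f_inj; rewrite range_inv_val.
by have := lip (Sub (f x) (fx_range x)) (Sub (f x') (fx_range x')); rewrite !invE.
Qed.

Lemma distortion_ge1 (R : realType) (X Y : metricType R) (f : X -> Y)
    (x x' : X) :
  bilipschitz_embedding f -> x <> x' -> 1 <= distortion f.
Proof.
move=> f_emb /eqP; rewrite -mdist_gt0 => d_gt0.
rewrite -(ler_pM2r d_gt0) mul1r (le_trans (dist_le_Lip_inv x x' f_emb)) //.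
rewrite /distortion mulrAC [leRHS]mulrC ler_wpM2l ?Lip_ge0 //.
exact: dist_le_Lip.
Qed.

Section PathCost.
Variables (R : realType) (X : metricType R).

Lemma path_cost_ge0 (a : nat -> X) (T : nat) : 0 <= path_cost a T.
Proof. by apply: sumr_ge0 => i _; exact: mdist_ge0. Qed.

Lemma offline_opt_ge0 (x0 : X) (Ks : seq (set X)) :
  (0 <= offline_opt x0 Ks)%E.
Proof.
by apply: le_ereal_inf_tmp => _ [a _ <-]; rewrite lee_fin path_cost_ge0.
Qed.

Lemma path_cost_le (Y : metricType R) (a : nat -> X) (b : nat -> Y) (T : nat)
    (k : R) :
  (forall t, (1 <= t <= T)%N ->
     mdist (a t) (a t.-1) <= k * mdist (b t) (b t.-1)) ->
  path_cost a T <= k * path_cost b T.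
Proof.
move=> le_ab; rewrite /path_cost mulr_sumr big_nat_cond [leRHS]big_nat_cond.
by apply: ler_sum => t /andP[t_le _]; exact: le_ab.
Qed.

End PathCost.

(** Clearing the denominator respects the conventions for ratios: at [o = +oo] both sides hold, and
    at [o = 0] both amount to [a = 0]. *)
Lemma ediv_le (R : realType) (a k : R) (o : \bar R) :
  0 <= a -> 0 < k -> (0 <= o)%E ->
  (a%:E / o <= k%:E)%E = (a%:E <= k%:E * o)%E.
Proof.
move=> a_ge0 k_gt0; case: o => [r| |] //; last first.
  by rewrite invey mule0 lee_fin (ltW k_gt0) gt0_muley ?lte_fin ?leey.
rewrite lee_fin le_eqVlt => /predU1P[<- |r_gt0]; last first.
  by rewrite inver gt_eqF // -!EFinM !lee_fin ler_pdivrMr.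
rewrite inve0 mule0 lee_fin.
have := a_ge0; rewrite le_eqVlt => /predU1P[<- |a_gt0].
  by rewrite mul0e lee_fin (ltW k_gt0) lexx.
by rewrite gt0_muley ?lte_fin // leNgt ltry [RHS]leNgt a_gt0.
Qed.

Section Transfer.
Variables (R : realType) (X Y : metricType R).
Variables (CX : set (set X)) (CY : set (set Y)) (f : X -> Y).
Variable AY : Y -> seq (set Y) -> Y.
Hypothesis f_emb : bilipschitz_embedding f.
Hypothesis f_req : forall K : set X, CX K -> CY (f @` K).
Hypothesis AY_online : online_algorithm CY AY.

Local Notation AX := (induced_algorithm f AY).
Local Notation image_requests Ks := [seq f @` K | K <- Ks].
Local Notation LipF := (Lip (@mdist R X) (@mdist R Y) f).
Local Notation LipI := (Lip (@range_dist R X Y f) (@mdist R X) (@range_inv X Y f)).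

Lemma image_requests_in (Ks : seq (set X)) :
  {in Ks, forall K, CX K} -> {in image_requests Ks, forall K, CY K}.
Proof. by move=> KsP _ /mapP[K /KsP KP ->]; exact: f_req. Qed.

Lemma response_in_image (x0 : X) (Ks : seq (set X)) (K : set X) :
  {in Ks, forall K, CX K} -> CX K ->
  (f @` K) (AY (f x0) (image_requests (rcons Ks K))).
Proof.
move=> KsP KP; rewrite map_rcons.
by apply: AY_online; [exact: image_requests_in | exact: f_req].
Qed.

(** On admissible requests the response of [AY] lies in the image of [f], so [insub] succeeds and
    the default is never returned. *)
Lemma induced_algorithmE (x0 : X) (Ks : seq (set X)) (K : set X) :
  {in Ks, forall K, CX K} -> CX K ->
  f (AX x0 (rcons Ks K)) = AY (f x0) (image_requests (rcons Ks K)).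
Proof.
move=> KsP KP; have [x _ fx] := response_in_image x0 KsP KP.
have AY_range : AY (f x0) (image_requests (rcons Ks K)) \in range f.
  by rewrite inE; exists x.
by rewrite /induced_algorithm insubT /= range_inv_val.
Qed.

Lemma induced_algorithm_online : online_algorithm CX AX.
Proof.
move=> x0 Ks K KsP KP; have [f_inj _ _] := f_emb.
have [x Kx] := response_in_image x0 KsP KP.
by rewrite -induced_algorithmE // => /f_inj <-.
Qed.

Lemma run_induced (x0 : X) (Ks : seq (set X)) (t : nat) :
  {in Ks, forall K, CX K} -> (t <= size Ks)%N ->
  f (run AX x0 Ks t) = run AY (f x0) (image_requests Ks) t.
Proof.
(* The prefix of length t+1 is split as [rcons] of its first t requests and the request of index t,
   the form in which responses are controlled. *)
case: t => [|t] // KsP lt_t /=; rewrite -map_take (take_nth set0) //.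
apply: induced_algorithmE => [K /mem_take /KsP //|].
exact/KsP/mem_nth.
Qed.

Lemma alg_cost_induced (x0 : X) (Ks : seq (set X)) :
  {in Ks, forall K, CX K} ->
  alg_cost AX x0 Ks <= LipI * alg_cost AY (f x0) (image_requests Ks).
Proof.
move=> KsP; rewrite /alg_cost size_map; apply: path_cost_le => t /andP[_ t_le].
rewrite -!run_induced // ?(leq_trans (leq_pred t)) //.
exact: dist_le_Lip_inv.
Qed.

Lemma offline_opt_image (x0 : X) (Ks : seq (set X)) :
  0 < LipF ->
  (offline_opt (f x0) (image_requests Ks) <= LipF%:E * offline_opt x0 Ks)%E.
Proof.
(* Dividing by the positive constant isolates the infimum, so the bound can be checked path by path:
   if [a] is feasible for [Ks], then [f \o a] is feasible for the image requests. *)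
move=> L_gt0; rewrite -lee_pdivrMl //.
apply: le_ereal_inf_tmp => _ [a [a0 aP] <-]; rewrite lee_pdivrMl //.
apply: (@le_trans _ _ (path_cost (f \o a) (size Ks))%:E).
  apply: ereal_inf_lbound; exists (f \o a); last by rewrite size_map.
  split=> [|t]; rewrite /= ?a0 // size_map => t_le.
  rewrite (nth_map set0); first by exists (a t) => //; exact: aP.
  by case: t t_le.
rewrite -EFinM lee_fin; apply: path_cost_le => t _.
exact: dist_le_Lip.
Qed.

(** If X had at most one point, both Lipschitz constants would be 0 and so would the right-hand
    side, whereas a competitive ratio is at least 1. *)
Lemma competitive_ratio_induced :
  (exists x x' : X, x <> x') ->
  (competitive_ratio CX AX <= competitive_ratio CY AY * (distortion f)%:E)%E.
Proof.
case=> x [x' xx']; have D_ge1 := distortion_ge1 f_emb xx'.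
have D_gt0 := lt_le_trans ltr01 D_ge1.
have L_gt0 : 0 < LipF.
  rewrite lt_def Lip_ge0 andbT; apply: contraTneq D_gt0.
  by rewrite /distortion => ->; rewrite mul0r ltxx.
have C_ge1 : (1 <= competitive_ratio CY AY)%E by rewrite le_max lexx.
have : forall y0 Js, {in Js, forall K, CY K} ->
    ((alg_cost AY y0 Js)%:E / offline_opt y0 Js <= competitive_ratio CY AY)%E.
  move=> y0 Js JsP; rewrite le_max; apply/orP; right.
  by apply: ereal_sup_ubound; exists y0, Js.
move: C_ge1; case: (competitive_ratio CY AY) => [c| |] //; last first.
  (* An infinite ratio stays infinite because the distortion is positive. *)
  by move=> _ _; rewrite gt0_mulye ?lte_fin ?leey.
rewrite lee_fin -EFinM => c_ge1 ratioY.
have c_gt0 := lt_le_trans ltr01 c_ge1.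
rewrite ge_max lee_fin mulr_ege1 //=; apply: ge_ereal_sup => _ [x0 [Ks [KsP ->]]].
rewrite ediv_le ?(mulr_gt0 c_gt0 D_gt0) ?path_cost_ge0 ?offline_opt_ge0 //.
have := ratioY (f x0) _ (image_requests_in KsP).
rewrite ediv_le ?path_cost_ge0 ?offline_opt_ge0 // => costY.
apply: (@le_trans _ _ (LipI * alg_cost AY (f x0) (image_requests Ks))%:E).
  by rewrite lee_fin alg_cost_induced.
(* The factors are put in order of use: [LipI] compares the costs, [c] compares cost with optimum in
   Y, and [LipF] compares the optima. *)
have -> : c * distortion f = LipI * c * LipF.
  by rewrite /distortion mulrA mulrC mulrA.
rewrite !EFinM -!muleA; apply: lee_wpmul2l; first by rewrite lee_fin Lip_ge0.
apply: (le_trans costY); apply: lee_wpmul2l; first by rewrite lee_fin ltW.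
exact: offline_opt_image.
Qed.

End Transfer.

Theorem lemma2p1 (R : realType) (X Y : metricType R)
    (CX : set (set X)) (CY : set (set Y)) (f : X -> Y)
    (f_emb : bilipschitz_embedding f)
    (f_req : forall K : set X, CX K -> CY (f @` K))
    (AY : Y -> seq (set Y) -> Y) (AY_online : online_algorithm CY AY) :
  online_algorithm CX (induced_algorithm f AY) /\
  ((exists x x' : X, x <> x') ->
   (competitive_ratio CX (induced_algorithm f AY)
      <= competitive_ratio CY AY * (distortion f)%:E)%E).
Proof.
split; first exact: (induced_algorithm_online f_emb f_req AY_online).
exact: competitive_ratio_induced.
Qed.
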